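(* Consider the RLC circuit $-L\dot I=\Gamma V+RI-Bu_s$, $C\dot V=\Gamma^\top I-GV$ and its extended dynamics (adjoining $-L\ddot I=\Gamma\dot V+R\dot I-B\upsilon_s$, $C\ddot V=\Gamma^\top\dot I-G\dot V$, $\dot u_s=\upsilon_s$), with extended state $(I,V,\dot I,\dot V,u_s)$ and input $\upsilon_s\in\mathbb{R}^m$. Assume: $L,C$ constant symmetric positive definite; $R,G$ symmetric positive semi-definite; $I,V$ (and $\dot I,\dot V$) are measured; and there exist constants $V^\star\in\mathbb{R}^\rho_+$, $\bar u_s\in\mathbb{R}^m$ and $\bar I\in\mathbb{R}^\sigma$ with $0=\Gamma V^\star+R\bar I-B\bar u_s$, $0=\Gamma^\top\bar I-GV^\star$. Apply the control $$\upsilon_s=\frac1{k_d}\big(\mu_s-k_i(u_s-\bar u_s)-y_s\big),\qquad y_s=B^\top\dot I,$$ with $k_d>0$, $k_i>0$ and new input $\mu_s\in\mathbb{R}^m$. Then: (a) the closed-loop system defines a passive map $\mu_s\mapsto\dot u_s$; (b) if $\mu_s=0$ and any of (i) $R>0$ and $G>0$; (ii) $R>0$ and $\Gamma$ has full column rank; (iii) $G>0$ and $\Gamma^\top$ has full column rank holds, then the solution of the closed-loop system asymptotically converges to the set $\{(I,V,\dot I,\dot V,u_s):\dot V=0,\dot I=0,\dot u_s=0,u_s=\bar u_s\}$; (c) if, in addition to one of the conditions in (b) (with $\mu_s=0$), the matrix $\mathcal{A}_s=\begin{bmatrix}R&\Gamma\\\Gamma^\top&-G\end{bmatrix}$ has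 full rank, then the solution of the closed-loop system asymptotically converges to the desired operating point $(\bar I,V^\star,0,0,\bar u_s)$, which is unique.
   Context: $I\in\mathbb{R}^\sigma$, $V\in\mathbb{R}^\rho$, $u_s\in\mathbb{R}^m$; $\Gamma\in\mathbb{R}^{\sigma\times\rho}$; $B\in\mathbb{R}^{\sigma\times m}$ has full column rank. A map $\mu\mapsto z$ is passive if there is a storage function $S\ge0$ of the closed-loop state with $\dot S\le\mu^\top z$ along trajectories. *)

(* Defs.v *)
From HB Require Import structures.
From mathcomp Require Import all_boot all_order all_algebra.
From mathcomp Require Import all_classical all_reals all_analysis.
Set Implicit Arguments. Unset Strict Implicit. Unset Printing Implicit Defensive.
Import Order.TTheory GRing.Theory Num.Theory.
Import numFieldNormedType.Exports.
Local Open Scope ring_scope.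

Definition qform (R : realType) n (A : 'M[R]_n) (x : 'cV[R]_n) : R :=
  (x^T *m A *m x) 0 0.

Definition sym_posdef (R : realType) n (A : 'M[R]_n) : Prop :=
  A^T = A /\ forall x : 'cV[R]_n, x != 0 -> 0 < qform A x.

Definition sym_psd (R : realType) n (A : 'M[R]_n) : Prop :=
  A^T = A /\ forall x : 'cV[R]_n, 0 <= qform A x.

Definition closed_loop (R : realType) (sig rho m : nat)
  (L Rm : 'M[R]_sig) (C G : 'M[R]_rho) (Gam : 'M[R]_(sig, rho))
  (B : 'M[R]_(sig, m)) (kd ki : R) (ubar : 'cV[R]_m)
  (mu : R -> 'cV[R]_m)
  (I : R -> 'cV[R]_sig) (V : R -> 'cV[R]_rho) (us : R -> 'cV[R]_m) : Prop :=
  forall t : R, 0 < t ->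
    [/\ derivable I t 1, derivable V t 1, derivable us t 1,
        derivable (derive1 I) t 1 & derivable (derive1 V) t 1] /\
    [/\ - (L *m (derive1 I) t) = Gam *m V t + Rm *m I t - B *m us t,
        C *m (derive1 V) t = Gam^T *m I t - G *m V t,
        - (L *m (derive1 (derive1 I)) t) = Gam *m (derive1 V) t + Rm *m (derive1 I) t - B *m (derive1 us) t,
        C *m (derive1 (derive1 V)) t = Gam^T *m (derive1 I) t - G *m (derive1 V) t &
        (derive1 us) t = kd^-1 *: (mu t - ki *: (us t - ubar) - B^T *m (derive1 I) t)].

Definition passive_mu_to_dus (R : realType) (sig rho m : nat)
  (L Rm : 'M[R]_sig) (C G : 'M[R]_rho) (Gam : 'M[R]_(sig, rho))
  (B : 'M[R]_(sig, m)) (kd ki : R) (ubar : 'cV[R]_m) : Prop :=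
  exists S : 'cV[R]_sig -> 'cV[R]_rho -> 'cV[R]_sig -> 'cV[R]_rho -> 'cV[R]_m -> R,
    (forall a b c d e, 0 <= S a b c d e) /\
    forall (mu : R -> 'cV[R]_m) I V us,
      closed_loop L Rm C G Gam B kd ki ubar mu I V us ->
      forall t : R, 0 < t ->
        let s := fun t => S (I t) (V t) ((derive1 I) t) ((derive1 V) t) (us t) in
        derivable s t 1 /\ (derive1 s) t <= ((mu t)^T *m (derive1 us) t) 0 0.

(* Main.v *)
Require Import Defs.
From HB Require Import structures.
From mathcomp Require Import all_boot all_order all_algebra.
From mathcomp Require Import all_classical all_reals all_analysis.
From mathcomp Require Import ring lra.
Import Order.TTheory GRing.Theory Num.Theory.
Import numFieldNormedType.Exports.
Set Implicit Arguments.
Unset Strict Implicit.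
Local Open Scope classical_set_scope.
Local Open Scope ring_scope.

(* With [i = I'], [v = V'], [e = us - ubar] and [w = us'], the storage function
   [S = (i^T L i + v^T C v + ki |e|^2) / 2] satisfies
   [S' = mu^T w - (i^T R i + v^T G v + kd |w|^2)], which is passivity.
   For [mu = 0] there is no need for LaSalle's theorem: [S] decreases, so
   [i], [v], [e], hence by linearity all their derivatives, are bounded, and a
   function that converges and has a bounded second derivative has a derivative
   tending to 0. Applied to [S], this kills the three dissipation terms; applied
   to [i] (or [v]) it gives [i' -> 0] (or [v' -> 0]), and the dynamics then
   yields [Gam v -> 0] (or [Gam^T i -> 0]). Finally [w -> 0] and [i -> 0] give
   [e -> 0] by the control law. *)

Lemma mxDE (R : realType) m n (A B : 'M[R]_(m, n)) i j :
  (A + B) i j = A i j + B i j.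
Proof. by rewrite mxE. Qed.

Lemma mxNE (R : realType) m n (A : 'M[R]_(m, n)) i j : (- A) i j = - A i j.
Proof. by rewrite mxE. Qed.

Lemma mxZE (R : realType) m n c (A : 'M[R]_(m, n)) i j :
  (c *: A) i j = c * A i j.
Proof. by rewrite mxE. Qed.

(** * Positive definite quadratic forms and their control of coordinates *)

Section QuadraticForms.
Context {R : realType} {n : nat}.
Implicit Types (A : 'M[R]_n) (x : 'cV[R]_n).

Lemma qform0 A : qform A 0 = 0.
Proof. by rewrite /qform mulmx0 mxE. Qed.

Lemma sym_posdef_psd A : sym_posdef A -> sym_psd A.
Proof.
move=> [symA posA]; split=> // x.
by have [->|/posA/ltW//] := eqVneq x 0; rewrite qform0.
Qed.

Lemma qform1 x : qform 1%:M x = \sum_i x i 0 ^+ 2.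
Proof.
by rewrite /qform mulmx1 mxE; apply: eq_bigr => i _; rewrite mxE expr2.
Qed.

(** Squared Euclidean norms thus count as positive definite forms, so that the bounds below also
    serve [e] and [w]. *)
Lemma sym_posdef1 : sym_posdef (1%:M : 'M[R]_n).
Proof.
split=> [|x x0]; first exact: trmx1.
have sq i : true -> 0 <= x i 0 ^+ 2 by rewrite sqr_ge0.
rewrite qform1 lt_neqAle sumr_ge0 ?andbT// eq_sym psumr_eq0//.
apply: contra x0 => /allP x0; apply/eqP/colP => i.
by have /eqP/eqP := x0 i (mem_index_enum i); rewrite sqrf_eq0 mxE => /eqP.
Qed.

Lemma qform1_ge0 x : 0 <= qform 1%:M x.
Proof. exact: (sym_posdef_psd sym_posdef1).2. Qed.

Lemma sym_posdef_unitmx A : sym_posdef A -> A \in unitmx.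
Proof.
move=> [symA posA]; rewrite -row_free_unit; apply: inj_row_free => v vA0.
apply/eqP; apply: contraT => v0.
have := posA v^T; rewrite trmx_eq0 => /(_ v0).
by rewrite /qform trmxK vA0 mul0mx mxE ltxx.
Qed.

(* Cauchy-Schwarz in the inner product of [A], between [x] and
   [A^-1 e_k]. *)
Lemma sym_posdef_coord_le A (k : 'I_n) : sym_posdef A ->
  exists2 c, 0 < c & forall x, x k 0 ^+ 2 <= c * qform A x.
Proof.
move=> pA; have uA := sym_posdef_unitmx pA; have [symA posA] := pA.
pose d : 'cV[R]_n := delta_mx k 0.
pose a := invmx A *m d.
have aA : a^T *m A = d^T by rewrite trmx_mul trmx_inv symA mulmxKV.
have Aa : A *m a = d by rewrite mulKVmx.
have a0 : a != 0.
  apply/eqP => a0; move: Aa; rewrite a0 mulmx0 => /colP/(_ k)/esym/eqP.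
  by rewrite !mxE !eqxx oner_eq0.
have dT (z : 'cV[R]_n) : (d^T *m z) 0 0 = z k 0.
  by rewrite trmx_delta -rowE mxE.
set p := qform A a; have p0 : 0 < p by rewrite posA.
exists p => // x; set q := qform A x; set y := x k 0.
have xAa : (x^T *m A *m a) 0 0 = y.
  rewrite -mulmxA Aa (_ : x^T *m d = (d^T *m x)^T); first by rewrite mxE dT.
  by rewrite trmx_mul trmxK.
have aAx : (a^T *m A *m x) 0 0 = y by rewrite aA dT.
(* Up to scaling, this vector is [x] minus its [A]-orthogonal projection on [a]. Its form equals
   [p * (p * q - y ^+ 2)], and dividing by [p] leaves the bound. *)
have := (sym_posdef_psd pA).2 (p *: x - y *: a).
have -> : qform A (p *: x - y *: a) = p * (p * q - y ^+ 2).
  rewrite /qform (_ : (p *: x - y *: a)^T = p *: x^T - y *: a^T); last first.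
    by rewrite linearB/= !linearZ.
  rewrite !(mulmxBl, mulmxBr) -!(scalemxAl, scalemxAr).
  rewrite !(mxDE, mxNE, mxZE) xAa aAx -/(qform A a) -/p -/(qform A x) -/q.
  ring.
by rewrite pmulr_rge0// subr_ge0.
Qed.

End QuadraticForms.

(** * Derivatives and limits of matrix-valued functions, entry by entry *)

Section MatrixCalculus.
Context {R : realType}.

Lemma is_derive_mxP (m n : nat) (A : R -> 'M[R]_(m, n)) (t : R) dA :
  is_derive t 1 A dA <-> forall i j, is_derive t 1 (fun s => A s i j) (dA i j).
Proof.
split=> [[drvA <-] i j|drvA].
  rewrite derive_mx// mxE; apply: derivableP.
  by move/derivable_mxP: drvA; apply.
have dA' : derivable A t 1 by apply/derivable_mxP => i j; have [] := drvA i j.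
split=> //; rewrite derive_mx//; apply/matrixP => i j; rewrite mxE.
by have [] := drvA i j.
Qed.

Lemma is_derive_mulmx (m n p : nat) (A : R -> 'M[R]_(m, n))
    (B : R -> 'M[R]_(n, p)) (t : R) dA dB :
  is_derive t 1 A dA -> is_derive t 1 B dB ->
  is_derive t 1 (fun s => A s *m B s) (dA *m B t + A t *m dB).
Proof.
move=> /is_derive_mxP hA /is_derive_mxP hB; apply/is_derive_mxP => i j.
rewrite !mxE -big_split/=.
have -> : (fun s => (A s *m B s) i j) =
    \sum_(k < n) ((fun s => A s i k) * (fun s => B s k j)).
  by apply/funext => s; rewrite mxE fct_sumE.
have := is_derive_sum (fun k => is_deriveM (hA i k) (hB k j)).
have <- : \sum_(k < n) (A t i k *: dB k j + B t k j *: dA i k) =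
  \sum_(k < n) (dA i k * B t k j + A t i k * dB k j); last by [].
by apply: eq_bigr => k _; rewrite /GRing.scale/= addrC mulrC.
Qed.

Lemma is_derive_mulmxl (m n p : nat) (M : 'M[R]_(m, n))
    (B : R -> 'M[R]_(n, p)) (t : R) dB :
  is_derive t 1 B dB -> is_derive t 1 (fun s => M *m B s) (M *m dB).
Proof.
move=> hB; have := is_derive_mulmx (is_derive_cst M t 1) hB.
by rewrite mul0mx add0r.
Qed.

Lemma is_derive_trmx (m n : nat) (A : R -> 'M[R]_(m, n)) (t : R) dA :
  is_derive t 1 A dA -> is_derive t 1 (fun s => (A s)^T) dA^T.
Proof.
move=> /is_derive_mxP hA; apply/is_derive_mxP => i j; rewrite mxE.
by under eq_fun do rewrite mxE.
Qed.

(** By symmetry of [A], the two terms of the product rule are transposes of each other, hence equal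
    as 1 by 1 matrices. *)
Lemma is_derive_qform (n : nat) (A : 'M[R]_n) (x : R -> 'cV[R]_n) (t : R) dx :
  A^T = A -> is_derive t 1 x dx ->
  is_derive t 1 (fun s => qform A (x s)) (2 * ((x t)^T *m A *m dx) 0 0).
Proof.
move=> symA hx.
have hxA := is_derive_mulmx (is_derive_trmx hx) (is_derive_cst A t 1).
have /is_derive_mxP/(_ 0 0) := is_derive_mulmx hxA hx.
rewrite mulmx0 addr0; suff <- : (dx^T *m A *m x t + (x t)^T *m A *m dx) 0 0 =
  2 * ((x t)^T *m A *m dx) 0 0 by [].
rewrite mxE.
have -> : dx^T *m A *m x t = ((x t)^T *m A *m dx)^T.
  by rewrite !trmx_mul trmxK symA mulmxA.
by rewrite mxE -mulr2n mulr_natl.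
Qed.

Lemma cvg_mxP (T : Type) (F : set_system T) (m n : nat)
    (A : T -> 'M[R]_(m, n)) (M : 'M[R]_(m, n)) : Filter F ->
  A t @[t --> F] --> M <-> forall i j, A t i j @[t --> F] --> M i j.
Proof.
move=> FF; split=> [AM i j|AM].
  exact: (cvg_comp _ _ AM (@coord_continuous _ _ _ i j M)).
apply/cvgrPdist_le => /= e e0; near=> t.
rewrite [leLHS]/Num.Def.normr/= mx_normrE (bigmax_le _ (ltW e0))//= => i _.
rewrite !mxE; move: i; near: t; apply: filter_forall => i.
by move/cvgrPdist_le: (AM i.1 i.2); exact.
Unshelve. all: by end_near. Qed.

Lemma cvg_mulmxl (T : Type) (F : set_system T) (m n p : nat)
    (M : 'M[R]_(m, n)) (A : T -> 'M[R]_(n, p)) B : Filter F ->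
  A t @[t --> F] --> B -> M *m A t @[t --> F] --> M *m B.
Proof.
move=> FF /cvg_mxP AB; apply/cvg_mxP => i j; rewrite mxE.
under eq_cvg do rewrite mxE.
apply: cvg_big => [z|k _]; first by apply: cvgD; [exact: cvg_fst|exact: cvg_snd].
by apply: cvgM; [exact: cvg_cst|exact: AB].
Qed.

Lemma cvg_mulmxl0 (T : Type) (F : set_system T) (m n p : nat)
    (M : 'M[R]_(m, n)) (A : T -> 'M[R]_(n, p)) : Filter F ->
  A t @[t --> F] --> (0 : 'M[R]_(n, p)) ->
  M *m A t @[t --> F] --> (0 : 'M[R]_(m, p)).
Proof. by move=> FF A0; rewrite -(mulmx0 _ M); exact: cvg_mulmxl. Qed.

End MatrixCalculus.

(** * Monotone convergence and a Barbalat-type lemma at infinity *)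

Section Barbalat.
Context {R : realType}.
Implicit Types (a : R) (f g h : R -> R).

Lemma cvgy_nonincr_ge0 a f g :
  (forall t, a < t -> is_derive t 1 f (g t)) ->
  (forall t, a < t -> g t <= 0) -> (forall t, a < t -> 0 <= f t) ->
  (forall x y, a < x -> x <= y -> f y <= f x) /\
  exists l : R, f t @[t --> +oo] --> l.
Proof.
move=> df g0 f0.
have drv t : a < t -> derivable f t 1 by move=> /df[].
have nincr x y : a < x -> x <= y -> f y <= f x.
  move=> ax xy; apply: (@ler0_derive1_nincry _ f x) => //.
  - by move=> t; rewrite in_itv/= andbT => xt; apply/drv/(lt_trans ax).
  - move=> t; rewrite in_itv/= andbT => xt; have at_ := lt_trans ax xt.
    by rewrite derive1E; case: (df _ at_) => _ ->; exact: g0.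
  - apply: derivable_within_continuous => t; rewrite in_itv/= andbT => xt.
    exact/drv/(lt_le_trans ax).
split=> //.
have a1 t : a < Num.max t (a + 1) by rewrite lt_max ltrDl ltr01 orbT.
(* Monotone convergence is applied to a function monotone on the whole line, so [f] is negated and
   frozen before [a + 1], a point strictly beyond [a]. *)
pose F t := - f (Num.max t (a + 1)).
have Fincr : {homo F : x y / x <= y}.
  move=> x y xy; rewrite lerN2; apply: nincr => //.
  by rewrite ge_max !le_max xy lexx orbT.
have Fub : has_ubound (range F).
  by exists 0 => _ [t _ <-]; rewrite oppr_le0; exact: f0.
exists (- sup (range F)).
apply: cvg_trans (cvgN (nondecreasing_cvgr Fincr Fub)).
apply: near_eq_cvg; near=> t; rewrite /= /F/= opprK.
by congr f; apply/max_idPl; near: t; apply: nbhs_pinfty_ge; exact: num_real.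
Unshelve. all: by end_near. Qed.

(* The mean value theorem gives [f (t + d) - f t = d * g c] with
   [c] in [t, t + d], while [g c] differs from [g t] by at most [K * d]. *)
Lemma cvgy_derive0 a f g h (l K : R) :
  (forall t, a < t -> is_derive t 1 f (g t)) ->
  (forall t, a < t -> is_derive t 1 g (h t)) ->
  (forall t, a < t -> `|h t| <= K) ->
  f t @[t --> +oo] --> l -> g t @[t --> +oo] --> (0 : R).
Proof.
move=> df dg hK fl; apply/(@cvgr0Pnorm_le R R) => e e0.
have K0 : 0 < `|K| + 1 by rewrite ltr_wpDl.
(* Over a length [d], [g] varies by at most [e / 2]; the [+ 1] keeps the denominator positive. *)
pose d := e / 2 / (`|K| + 1).
have d0 : 0 < d by rewrite !divr_gt0.
have fd : f (t + d) - f t @[t --> +oo] --> (0 : R).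
  by rewrite -(subrr l); apply: cvgB => //; rewrite (cvg_shiftr d f l).
have cont (u u' : R -> R) x y : a < x ->
    (forall t, a < t -> is_derive t 1 u (u' t)) -> {within `[x, y], continuous u}.
  move=> ax du; apply: derivable_within_continuous => s.
  by rewrite in_itv/= => /andP[xs _]; have [] := du _ (lt_le_trans ax xs).
have inside x y s : a < x -> s \in `]x, y[ -> a < s.
  by move=> ax; rewrite in_itv/= => /andP[/(lt_trans ax)].
near=> t.
have at_ : a < t by near: t; apply: nbhs_pinfty_gt; exact: num_real.
have [|s tds||c] := @MVT _ f g t (t + d); first by rewrite ltrDl.
  exact/df/inside/tds.
  exact: cont df.
rewrite in_itv/= addrAC subrr add0r => /andP[tc ctd] fE.
have [s tds||b] := @MVT _ g h t c tc.
  exact/dg/inside/tds.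
  exact: cont dg.
move=> tb gE.
(* Convergence of [f] makes this increment small for large [t]; dividing by [d] then bounds [g c] by
   [e / 2]. *)
have ftd : `|f (t + d) - f t| <= d * (e / 2).
  by near: t; move/cvgr0Pnorm_le: fd; apply; rewrite mulr_gt0// divr_gt0.
have gc : `|g c| <= e / 2.
  by move: ftd; rewrite fE normrM (gtr0_norm d0) mulrC ler_pM2l.
have gtc : `|g c - g t| <= e / 2.
  rewrite gE normrM (gtr0_norm (_ : 0 < c - t)) ?subr_gt0//.
  rewrite (_ : e / 2 = (`|K| + 1) * d); last first.
    by rewrite /d mulrCA divff ?mulr1// gt_eqF.
  apply: ler_pM => //; first by rewrite subr_ge0 ltW.
    rewrite (le_trans (hK _ (inside _ _ _ at_ tb)))//.
    by rewrite (le_trans (ler_norm _))// lerDl.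
  by rewrite lerBlDl ltW.
rewrite (_ : g t = g c - (g c - g t)); last by rewrite subKr.
by rewrite (le_trans (ler_normB _ _))// (splitr e) lerD.
Unshelve. all: by end_near. Qed.

End Barbalat.

(** * Transfer of derivatives and limits between functions that agree beyond [a] *)

Section EventuallyEqual.
Context {R : realType} {W : normedModType R} (a : R) (f g : R -> W).
Hypothesis fg : forall t, a < t -> f t = g t.

Lemma eq_is_derive_gt t d : a < t -> is_derive t 1 f d -> is_derive t 1 g d.
Proof.
move=> at_; apply: near_eq_is_derive.
by near=> s; apply: fg; near: s; exact: lt_nbhsr.
Unshelve. all: by end_near. Qed.

Lemma eq_cvgy (l : W) : f t @[t --> +oo] --> l -> g t @[t --> +oo] --> l.
Proof.
apply: cvg_trans; apply: near_eq_cvg; near=> t; apply: fg.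
by near: t; apply: nbhs_pinfty_gt; exact: num_real.
Unshelve. all: by end_near. Qed.

End EventuallyEqual.

(** * Bounded matrix functions, and boundedness or decay read off a quadratic form *)

Section Boundedness.
Context {R : realType} (a : R).

Definition mx_bounded (m n : nat) (A : R -> 'M[R]_(m, n)) :=
  forall i j, exists K, forall t, a < t -> `|A t i j| <= K.

Lemma mx_boundedD (m n : nat) (A B : R -> 'M[R]_(m, n)) :
  mx_bounded A -> mx_bounded B -> mx_bounded (fun t => A t + B t).
Proof.
move=> bA bB i j; have [K AK] := bA i j; have [K' BK'] := bB i j.
exists (K + K') => t at_; rewrite mxE (le_trans (ler_normD _ _))// lerD//.
  exact: AK.
exact: BK'.
Qed.

Lemma eq_mx_bounded (m n : nat) (A B : R -> 'M[R]_(m, n)) :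
  (forall t, a < t -> A t = B t) -> mx_bounded A -> mx_bounded B.
Proof.
by move=> AB bA i j; have [K AK] := bA i j; exists K => t at_; rewrite -AB ?AK.
Qed.

Lemma mx_bounded_cst (m n : nat) (M : 'M[R]_(m, n)) : mx_bounded (fun=> M).
Proof. by move=> i j; exists `|M i j|. Qed.

Lemma mx_boundedM (m n p : nat) (A : R -> 'M[R]_(m, n)) (B : R -> 'M[R]_(n, p)) :
  mx_bounded A -> mx_bounded B -> mx_bounded (fun t => A t *m B t).
Proof.
move=> bA bB i j.
have /choice[K AK] k := bA i k; have /choice[K' BK'] k := bB k j.
exists (\sum_k K k * K' k) => t at_; rewrite mxE (le_trans (ler_norm_sum _ _ _))//.
by apply: ler_sum => k _; rewrite normrM ler_pM// ?AK ?BK'.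
Qed.

Lemma mx_boundedZ (m n : nat) (c : R) (A : R -> 'M[R]_(m, n)) :
  mx_bounded A -> mx_bounded (fun t => c *: A t).
Proof.
move=> /(mx_boundedM (mx_bounded_cst c%:M)) bA i j; have [K AK] := bA i j.
by exists K => t /AK; rewrite mul_scalar_mx.
Qed.

Lemma mx_boundedN (m n : nat) (A : R -> 'M[R]_(m, n)) :
  mx_bounded A -> mx_bounded (fun t => - A t).
Proof.
by move=> bA i j; have [K AK] := bA i j; exists K => t /AK; rewrite mxE normrN.
Qed.

Lemma mx_boundedB (m n : nat) (A B : R -> 'M[R]_(m, n)) :
  mx_bounded A -> mx_bounded B -> mx_bounded (fun t => A t - B t).
Proof. by move=> bA bB; apply: mx_boundedD => //; exact: mx_boundedN. Qed.

Lemma mx_boundedMl (m n p : nat) (M : 'M[R]_(m, n)) (A : R -> 'M[R]_(n, p)) :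
  mx_bounded A -> mx_bounded (fun t => M *m A t).
Proof. by apply: mx_boundedM; exact: mx_bounded_cst. Qed.

Lemma mx_bounded_trmx (m n : nat) (A : R -> 'M[R]_(m, n)) :
  mx_bounded A -> mx_bounded (fun t => (A t)^T).
Proof.
by move=> bA i j; have [K AK] := bA j i; exists K => t /AK; rewrite mxE.
Qed.

Lemma cvgy_derive0_mx (m n : nat) (A B D : R -> 'M[R]_(m, n)) (M : 'M[R]_(m, n)) :
  (forall t, a < t -> is_derive t 1 A (B t)) ->
  (forall t, a < t -> is_derive t 1 B (D t)) ->
  mx_bounded D -> A t @[t --> +oo] --> M -> B t @[t --> +oo] --> (0 : 'M[R]_(m, n)).
Proof.
move=> dA dB bD /cvg_mxP AM; apply/cvg_mxP => i j; rewrite mxE.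
have [K DK] := bD i j.
apply: (@cvgy_derive0 _ a (fun t => A t i j) (fun t => B t i j)
  (fun t => D t i j) (M i j) K) => // t at_.
- by have /is_derive_mxP := dA t at_; exact.
- by have /is_derive_mxP := dB t at_; exact.
Qed.

Lemma qform_bounded (n : nat) (A : 'M[R]_n) (x : R -> 'cV[R]_n) K :
  sym_posdef A -> (forall t, a < t -> qform A (x t) <= K) -> mx_bounded x.
Proof.
move=> pA xK i j; rewrite (ord1 j).
have [c c0 xc] := sym_posdef_coord_le i pA.
(* The inequality [2 * r <= 1 + r ^+ 2], from the square of [r - 1], replaces a square root. *)
exists (1 + c * K) => t at_.
have := le_trans (xc (x t)) (ler_wpM2l (ltW c0) (xK t at_)).
rewrite -(real_normK (num_real (x t i 0))); have := sqr_ge0 (`|x t i 0| - 1); nra.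
Qed.

Lemma qform_cvg0 (n : nat) (A : 'M[R]_n) (x : R -> 'cV[R]_n) :
  sym_posdef A -> qform A (x t) @[t --> +oo] --> (0 : R) ->
  x t @[t --> +oo] --> (0 : 'cV[R]_n).
Proof.
move=> pA xA0; apply/cvg_mxP => i j; rewrite (ord1 j) mxE.
apply/(@cvgr0Pnorm_le R R) => e e0.
have [c c0 xc] := sym_posdef_coord_le i pA.
(* Once the form is at most [e ^+ 2 / c], the squared coordinate is at most [e ^+ 2]. *)
have ec0 : 0 < e ^+ 2 / c by rewrite divr_gt0// exprn_gt0.
near=> t; rewrite -(@ler_pXn2r _ 2)// ?nnegrE ?(ltW e0)// real_normK ?num_real//.
rewrite (le_trans (xc _))// mulrC -ler_pdivlMr// (le_trans (ler_norm _))//.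
by near: t; move/(@cvgr0Pnorm_le R R): xA0; apply.
Unshelve. all: by end_near. Qed.

End Boundedness.

(** * The storage function and its dissipation equality *)

Section Storage.
Context {R : realType} {sig rho m : nat}.
Variables (L Rm : 'M[R]_sig) (C G : 'M[R]_rho) (Gam : 'M[R]_(sig, rho)).
Variables (B : 'M[R]_(sig, m)) (kd ki : R) (ubar : 'cV[R]_m).

(** The circuit energy evaluated at the derivatives of current and voltage, plus the potential of
    the integral action. *)
Definition storage (_ : 'cV[R]_sig) (_ : 'cV[R]_rho) (i : 'cV[R]_sig)
    (v : 'cV[R]_rho) (u : 'cV[R]_m) : R :=
  2^-1 * (qform L i + qform C v + ki * qform 1%:M (u - ubar)).

Lemma storage_ge0 a b c d e : sym_posdef L -> sym_posdef C -> 0 < ki ->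
  0 <= storage a b c d e.
Proof.
move=> /sym_posdef_psd[_ L0] /sym_posdef_psd[_ C0] ki0.
by rewrite mulr_ge0 ?invr_ge0// !addr_ge0// mulr_ge0 ?qform1_ge0// ltW.
Qed.

(** Two exchanges of power cancel: [i^T Gam v] between inductors and capacitors, and [i^T B w]
    between inductors and controller. Only the supplied power and the dissipation remain. *)
Lemma is_derive_storage mu I V us (t : R) :
  L^T = L -> C^T = C -> 0 < kd ->
  closed_loop L Rm C G Gam B kd ki ubar mu I V us -> 0 < t ->
  is_derive t 1
    (fun s => storage (I s) (V s) (derive1 I s) (derive1 V s) (us s))
    (((mu t)^T *m derive1 us t) 0 0 -
      (qform Rm (derive1 I t) + qform G (derive1 V t)
        + kd * qform 1%:M (derive1 us t))).
Proof.
move=> symL symC kd0 cl t0.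
have [[_ _ drvu drvi drvv] [_ _ eqI eqV eqw]] := cl t t0.
have di := derivableP drvi; have dv := derivableP drvv.
have du := derivableP drvu; rewrite -!derive1E in di dv du.
have de : is_derive t 1 (fun s => us s - ubar) (derive1 us t).
  by have := is_deriveB du (is_derive_cst ubar t 1); rewrite subr0.
have := is_deriveZ 2^-1 (is_deriveD (is_deriveD (is_derive_qform symL di)
  (is_derive_qform symC dv)) (is_deriveZ ki (is_derive_qform (trmx1 _ _) de))).
move: eqI eqV eqw; set i := derive1 I t; set v := derive1 V t.
set w := derive1 us t; set i' := derive1 (derive1 I) t.
set v' := derive1 (derive1 V) t; set e := us t - ubar => eqI eqV eqw.
have eI : (i^T *m L *m i') 0 0 =
    (i^T *m B *m w) 0 0 - (i^T *m Gam *m v) 0 0 - qform Rm i.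
  rewrite -mulmxA -[L *m i']opprK eqI /qform.
  by rewrite !(mulmxN, mulmxDr) !mulmxA !(mxNE, mxDE); ring.
have eV : (v^T *m C *m v') 0 0 = (i^T *m Gam *m v) 0 0 - qform G v.
  rewrite -mulmxA eqV /qform !(mulmxN, mulmxDr) !mulmxA !(mxNE, mxDE).
  have -> : v^T *m Gam^T *m i = (i^T *m Gam *m v)^T.
    by rewrite !trmx_mul trmxK mulmxA.
  by rewrite mxE.
have ew : ki * (e^T *m 1%:M *m w) 0 0 =
    ((mu t)^T *m w) 0 0 - kd * qform 1%:M w - (i^T *m B *m w) 0 0.
  (* The transposed control law, solved for the output [B^T i]. *)
  have -> : i^T *m B = (mu t)^T - kd *: w^T - ki *: e^T.
    rewrite -[LHS]trmxK trmx_mul trmxK -!linearZ -!linearB/=; congr trmx.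
    rewrite [in RHS]eqw scalerA divff ?gt_eqF// scale1r.
    by rewrite -[_ - B^T *m i]addrA -opprD subKr addrC addKr.
  rewrite /qform !mulmx1 !mulmxBl -!scalemxAl !(mxDE, mxNE, mxZE); ring.
suff <- : 2^-1 *: (2 * (i^T *m L *m i') 0 0 + 2 * (v^T *m C *m v') 0 0 +
    ki *: (2 * (e^T *m 1%:M *m w) 0 0)) =
  ((mu t)^T *m w) 0 0 - (qform Rm i + qform G v + kd * qform 1%:M w) by [].
rewrite /GRing.scale/= (mulrCA ki) ew eI eV; by field.
Qed.

End Storage.

(** * Convergence of the unforced closed loop *)

Section AsymptoticConvergence.
Context {R : realType} {sig rho m : nat}.
Variables (L Rm : 'M[R]_sig) (C G : 'M[R]_rho) (Gam : 'M[R]_(sig, rho)).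
Variables (B : 'M[R]_(sig, m)) (kd ki : R) (ubar : 'cV[R]_m).
Hypotheses (pL : sym_posdef L) (pC : sym_posdef C).
Hypotheses (psdR : sym_psd Rm) (psdG : sym_psd G).
Hypotheses (kd0 : 0 < kd) (ki0 : 0 < ki).
Variables (I : R -> 'cV[R]_sig) (V : R -> 'cV[R]_rho) (us : R -> 'cV[R]_m).
Hypothesis cl : closed_loop L Rm C G Gam B kd ki ubar (fun=> 0) I V us.

(* [i], [v], [w] are the derivatives of [I], [V], [us]; the primed functions
   are the right-hand sides of the dynamics, so that they agree with the
   derivatives of the unprimed ones at positive times only. *)
Let i : R -> 'cV[R]_sig := derive1 I.
Let v : R -> 'cV[R]_rho := derive1 V.
Let e t := us t - ubar.
Let w : R -> 'cV[R]_m := derive1 us.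
Let i' t := invmx L *m (B *m w t - Gam *m v t - Rm *m i t).
Let v' t := invmx C *m (Gam^T *m i t - G *m v t).
Let w' t := kd^-1 *: (- (ki *: w t) - B^T *m i' t).
Let i'' t := invmx L *m (B *m w' t - Gam *m v' t - Rm *m i' t).
Let v'' t := invmx C *m (Gam^T *m i' t - G *m v' t).

Lemma derive1_iE (t : R) : 0 < t -> derive1 i t = i' t.
Proof.
move=> /cl[_ [_ _ eqI _ _]]; apply: (canRL (mulKmx (sym_posdef_unitmx pL))).
rewrite -[LHS]opprK [X in - X]eqI -/i -/v -/w !opprD opprK.
by rewrite addrC addrA.
Qed.

Lemma derive1_vE (t : R) : 0 < t -> derive1 v t = v' t.
Proof.
move=> /cl[_ [_ _ _ eqV _]]; rewrite /v' /i /v -eqV.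
by rewrite mulKmx// sym_posdef_unitmx.
Qed.

Lemma wE (t : R) : 0 < t -> w t = kd^-1 *: (- (ki *: e t) - B^T *m i t).
Proof. by move=> /cl[_ [_ _ _ _]]; rewrite sub0r. Qed.

Lemma is_derive_i (t : R) : 0 < t -> is_derive t 1 i (i' t).
Proof.
move=> t0; rewrite -(derive1_iE t0) derive1E; apply: derivableP.
by have [[]] := cl t0.
Qed.

Lemma is_derive_v (t : R) : 0 < t -> is_derive t 1 v (v' t).
Proof.
move=> t0; rewrite -(derive1_vE t0) derive1E; apply: derivableP.
by have [[]] := cl t0.
Qed.

Lemma is_derive_e (t : R) : 0 < t -> is_derive t 1 e (w t).
Proof.
move=> t0; have [[_ _ /derivableP du _ _] _] := cl t0.
by have := is_deriveB du (is_derive_cst ubar t 1); rewrite subr0 -derive1E.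
Qed.

(** [closed_loop] assumes no second derivative of [us]; the control law supplies it, since it
    expresses [w] through the differentiable [e] and [i]. *)
Lemma is_derive_w (t : R) : 0 < t -> is_derive t 1 w (w' t).
Proof.
move=> t0; apply: (eq_is_derive_gt (fun s (s0 : 0 < s) => esym (wE s0)) t0).
exact: is_deriveZ (is_deriveB (is_deriveN (is_deriveZ ki (is_derive_e t0)))
  (is_derive_mulmxl B^T (is_derive_i t0))).
Qed.

Lemma is_derive_i' (t : R) : 0 < t -> is_derive t 1 i' (i'' t).
Proof.
move=> t0; apply: is_derive_mulmxl; apply: is_deriveB.
  apply: is_deriveB; apply: is_derive_mulmxl; first exact: is_derive_w.
  exact: is_derive_v.
by apply: is_derive_mulmxl; exact: is_derive_i.
Qed.

Lemma is_derive_v' (t : R) : 0 < t -> is_derive t 1 v' (v'' t).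
Proof.
move=> t0; apply: is_derive_mulmxl; apply: is_deriveB; apply: is_derive_mulmxl.
  exact: is_derive_i.
exact: is_derive_v.
Qed.

Let S t := storage L C ki ubar (I t) (V t) (i t) (v t) (us t).
Let Q t := qform Rm (i t) + qform G (v t) + kd * qform 1%:M (w t).

Lemma is_derive_S (t : R) : 0 < t -> is_derive t 1 S (- Q t).
Proof.
move=> t0; have := is_derive_storage pL.1 pC.1 kd0 cl t0.
by rewrite trmx0 mul0mx mxE sub0r.
Qed.

Lemma Q_ge0 (t : R) : 0 <= Q t.
Proof.
by rewrite !addr_ge0 ?psdR.2 ?psdG.2// mulr_ge0 ?qform1_ge0// ltW.
Qed.

(** The reference time is 1 because the dynamics hold at positive times only, which excludes
    comparing with time 0. *)
Lemma S_nonincr_cvg : (forall t, 1 < t -> S t <= S 1) /\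
  exists l : R, S t @[t --> +oo] --> l.
Proof.
have [||mon ?] := @cvgy_nonincr_ge0 R 0 S (fun t => - Q t) is_derive_S.
- by move=> t _; rewrite oppr_le0 Q_ge0.
- by move=> t _; exact: storage_ge0.
by split=> // t /ltW; apply: mon.
Qed.

(** The three summands of [2 * S t] are nonnegative, so each is at most [2 * S 1]. *)
Lemma ive_bounded : [/\ mx_bounded 1 i, mx_bounded 1 v & mx_bounded 1 e].
Proof.
have [S1 _] := S_nonincr_cvg.
have qL t : 0 <= qform L (i t) by exact: (sym_posdef_psd pL).2.
have qC t : 0 <= qform C (v t) by exact: (sym_posdef_psd pC).2.
have q1 t : 0 <= ki * qform 1%:M (e t) by rewrite mulr_ge0 ?qform1_ge0 ?ltW.
split.
- apply: (qform_bounded (K := 2 * S 1) pL) => t /S1; rewrite {1}/S /storage -/(e t).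
  by move: (qL t) (qC t) (q1 t); lra.
- apply: (qform_bounded (K := 2 * S 1) pC) => t /S1; rewrite {1}/S /storage -/(e t).
  by move: (qL t) (qC t) (q1 t); lra.
- apply: (qform_bounded (K := 2 * S 1 / ki) sym_posdef1) => t /S1.
  rewrite {1}/S /storage -/(e t) ler_pdivlMr// mulrC.
  by move: (qL t) (qC t) (q1 t); lra.
Qed.

Lemma w_bounded : mx_bounded 1 w.
Proof.
have [bi _ be] := ive_bounded.
apply: (@eq_mx_bounded _ _ _ _ (fun t => kd^-1 *: (- (ki *: e t) - B^T *m i t))).
  by move=> t t1; rewrite wE// (lt_trans ltr01).
apply/mx_boundedZ/mx_boundedB; first exact/mx_boundedN/mx_boundedZ.
exact: mx_boundedMl.
Qed.

Lemma derivs_bounded : [/\ mx_bounded 1 i', mx_bounded 1 v', mx_bounded 1 w',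
  mx_bounded 1 i'' & mx_bounded 1 v''].
Proof.
have [bi bv _] := ive_bounded; have bw := w_bounded.
have bi' : mx_bounded 1 i'.
  by apply/mx_boundedMl/mx_boundedB; first apply: mx_boundedB; exact: mx_boundedMl.
have bv' : mx_bounded 1 v'.
  by apply/mx_boundedMl/mx_boundedB; exact: mx_boundedMl.
have bw' : mx_bounded 1 w'.
  apply/mx_boundedZ/mx_boundedB; first exact/mx_boundedN/mx_boundedZ.
  exact: mx_boundedMl.
split=> //.
- by apply/mx_boundedMl/mx_boundedB; first apply: mx_boundedB; exact: mx_boundedMl.
- by apply/mx_boundedMl/mx_boundedB; exact: mx_boundedMl.
Qed.

Lemma Q_cvg0 : Q t @[t --> +oo] --> (0 : R).
Proof.
have [_ [l Sl]] := S_nonincr_cvg.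
have [bi bv _] := ive_bounded; have [bi' bv' bw' _ _] := derivs_bounded.
(* The derivative of [- Q], that is, the second derivative of [S], kept as a 1 by 1 matrix so that
   the boundedness lemmas apply. *)
pose D t := - (2 *: ((i t)^T *m Rm *m i' t) + 2 *: ((v t)^T *m G *m v' t)
  + kd *: (2 *: ((w t)^T *m 1%:M *m w' t))).
have bform n (x y : R -> 'cV[R]_n) (M : 'M[R]_n) : mx_bounded 1 x ->
    mx_bounded 1 y -> mx_bounded 1 (fun t => (x t)^T *m M *m y t).
  move=> bx yb; apply: mx_boundedM => //; apply: mx_boundedM.
    exact: mx_bounded_trmx.
  exact: mx_bounded_cst.
have /(_ 0 0)[K DK] : mx_bounded 1 D.
  apply: mx_boundedN; apply: mx_boundedD; last first.
    by do 2 apply: mx_boundedZ; apply: bform => //; exact: w_bounded.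
  by apply: mx_boundedD; apply: mx_boundedZ; exact: bform.
have pos t : 1 < t -> 0 < t by apply: lt_trans.
suff NQ0 : - Q t @[t --> +oo] --> (0 : R).
  rewrite (_ : Q = fun t => - - Q t); last by apply/funext => t; rewrite opprK.
  by rewrite -[0]oppr0; exact: cvgN NQ0.
apply: (@cvgy_derive0 R 1 S (fun t => - Q t) (fun t => D t 0 0) l K _ _ DK Sl)
  => t /pos t0; first exact: is_derive_S.
have := is_deriveN (is_deriveD (is_deriveD
  (is_derive_qform psdR.1 (is_derive_i t0))
  (is_derive_qform psdG.1 (is_derive_v t0)))
  (is_deriveZ kd (is_derive_qform (trmx1 _ _) (is_derive_w t0)))).
by rewrite /D !(mxNE, mxDE, mxZE).
Qed.

(** Each term of [Q] is squeezed between 0 and [Q], the others being nonnegative. *)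
Lemma dissipation_cvg0 : [/\ qform Rm (i t) @[t --> +oo] --> (0 : R),
  qform G (v t) @[t --> +oo] --> (0 : R) & w t @[t --> +oo] --> (0 : 'cV[R]_m)].
Proof.
have qR t : 0 <= qform Rm (i t) by exact: psdR.2.
have qG t : 0 <= qform G (v t) by exact: psdG.2.
have q1 t : 0 <= kd * qform 1%:M (w t) by rewrite mulr_ge0 ?qform1_ge0 ?ltW.
split.
- apply: (squeeze_cvgr _ (cvg_cst 0) Q_cvg0); near=> t.
  by rewrite qR /Q; move: (qG t) (q1 t); lra.
- apply: (squeeze_cvgr _ (cvg_cst 0) Q_cvg0); near=> t.
  by rewrite qG /Q; move: (qR t) (q1 t); lra.
- apply: (qform_cvg0 sym_posdef1).
  have Qkd : kd^-1 * Q t @[t --> +oo] --> (0 : R).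
    by rewrite -[X in _ --> X](mulr0 kd^-1); apply: cvgM Q_cvg0; exact: cvg_cst.
  apply: (squeeze_cvgr _ (cvg_cst 0) Qkd); near=> t.
  rewrite qform1_ge0 mulrC ler_pdivlMr// mulrC /Q.
  by move: (qR t) (qG t); lra.
Unshelve. all: by end_near. Qed.

Lemma i'_cvg0 : i t @[t --> +oo] --> (0 : 'cV[R]_sig) ->
  i' t @[t --> +oo] --> (0 : 'cV[R]_sig).
Proof.
have [_ _ _ bi'' _] := derivs_bounded.
apply: (cvgy_derive0_mx _ _ bi'') => t t1; have t0 := lt_trans ltr01 t1.
  exact: is_derive_i.
exact: is_derive_i'.
Qed.

Lemma v'_cvg0 : v t @[t --> +oo] --> (0 : 'cV[R]_rho) ->
  v' t @[t --> +oo] --> (0 : 'cV[R]_rho).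
Proof.
have [_ _ _ _ bv''] := derivs_bounded.
apply: (cvgy_derive0_mx _ _ bv'') => t t1; have t0 := lt_trans ltr01 t1.
  exact: is_derive_v.
exact: is_derive_v'.
Qed.

Lemma closed_loop_cvg :
  (sym_posdef Rm /\ sym_posdef G) \/ (sym_posdef Rm /\ \rank Gam = rho)
     \/ (sym_posdef G /\ \rank Gam^T = sig) ->
  [/\ derive1 V t @[t --> +oo] --> (0 : 'cV[R]_rho),
      derive1 I t @[t --> +oo] --> (0 : 'cV[R]_sig),
      derive1 us t @[t --> +oo] --> (0 : 'cV[R]_m) &
      us t @[t --> +oo] --> ubar].
Proof.
have [qR0 qG0 w0] := dissipation_cvg0 => cond.
have [i0 v0] : i t @[t --> +oo] --> (0 : 'cV[R]_sig) /\
    v t @[t --> +oo] --> (0 : 'cV[R]_rho).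
  case: cond => [[pR pG]|[[pR rk]|[pG rk]]].
  - by split; [exact: qform_cvg0 qR0|exact: qform_cvg0 qG0].
  - have i0 := qform_cvg0 pR qR0; split=> //.
    (* [P] is a left inverse of [Gam]; it recovers [v] from [Gam v = B w - Rm i - L i'], whose
       right-hand side tends to 0. *)
    have /row_fullP[P PG] : row_full Gam by rewrite /row_full rk.
    apply: (@eq_cvgy _ _ 0 (fun t => P *m (B *m w t - Rm *m i t - L *m i' t))).
      move=> t t0; rewrite /i' mulKVmx ?sym_posdef_unitmx//.
      by rewrite [_ - Gam *m _ - _]addrAC subKr mulmxA PG mul1mx.
    apply: cvg_mulmxl0; rewrite -[0]subr0 -[X in X - _]subr0.
    apply: cvgB; last by apply: cvg_mulmxl0; exact: i'_cvg0.
    by apply: cvgB; exact: cvg_mulmxl0.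
  - have v0 := qform_cvg0 pG qG0; split=> //.
    (* Dually, [P] recovers [i] from [Gam^T i = C v' + G v]. *)
    have /row_fullP[P PG] : row_full Gam^T by rewrite /row_full rk.
    apply: (@eq_cvgy _ _ 0 (fun t => P *m (C *m v' t + G *m v t))).
      move=> t t0; rewrite /v' mulKVmx ?sym_posdef_unitmx//.
      by rewrite subrK mulmxA PG mul1mx.
    apply: cvg_mulmxl0; rewrite -[0]addr0.
    by apply: cvgD; apply: cvg_mulmxl0; [exact: v'_cvg0|].
split=> //.
(* The control law solved for [us], with correction terms that vanish in the limit. *)
apply: (@eq_cvgy _ _ 0
    (fun t => - ki^-1 *: (kd *: w t + B^T *m i t) + ubar)).
  move=> t t0; rewrite wE// scalerA divff ?gt_eqF// scale1r subrK.
  by rewrite scalerN scaleNr opprK scalerA mulVf ?gt_eqF// scale1r subrK.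
rewrite -[X in _ --> X]add0r; apply: cvgD; last exact: cvg_cst.
rewrite -(scaler0 _ (- ki^-1)); apply: cvgZ; first exact: cvg_cst.
rewrite -[0]addr0; apply: cvgD; last exact: cvg_mulmxl0.
by rewrite -(scaler0 _ kd); apply: cvgZ w0; exact: cvg_cst.
Qed.

End AsymptoticConvergence.

(** * Inversion of the steady-state equations *)

Section SteadyStateMatrix.
Context {R : realType} {sig rho : nat}.
Variables (Rm : 'M[R]_sig) (G : 'M[R]_rho) (Gam : 'M[R]_(sig, rho)).

(** The four matrices are the blocks of a left inverse. They recover [(x, y)] linearly from the two
    steady-state expressions, which yields both convergence and uniqueness in (c). *)
Lemma steady_state_solve :
  \rank (block_mx Rm Gam Gam^T (- G)) = (sig + rho)%N ->
  exists (P : 'M[R]_(sig, sig)) (P' : 'M[R]_(sig, rho))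
         (N : 'M[R]_(rho, sig)) (N' : 'M[R]_(rho, rho)),
    forall (x : 'cV[R]_sig) (y : 'cV[R]_rho),
      x = P *m (Gam *m y + Rm *m x) + P' *m (Gam^T *m x - G *m y) /\
      y = N *m (Gam *m y + Rm *m x) + N' *m (Gam^T *m x - G *m y).
Proof.
move=> rk; have /row_fullP[A AA] : row_full (block_mx Rm Gam Gam^T (- G)).
  by rewrite /row_full rk.
exists (ulsubmx A), (ursubmx A), (dlsubmx A), (drsubmx A) => x y.
have : A *m (block_mx Rm Gam Gam^T (- G) *m col_mx x y) = col_mx x y.
  by rewrite mulmxA AA mul1mx.
rewrite -[A]submxK !mul_block_col mulNmx (addrC (Rm *m x)) block_mxKul.
rewrite block_mxKur block_mxKdl block_mxKdr.
by move=> /eq_col_mx[-> ->].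
Qed.

End SteadyStateMatrix.

(** * Passivity, convergence and uniqueness of the operating point *)

Unset Implicit Arguments.

Theorem theorem3 (R : realType) (sig rho m : nat)
  (L Rm : 'M[R]_sig) (C G : 'M[R]_rho) (Gam : 'M[R]_(sig, rho))
  (B : 'M[R]_(sig, m)) (kd ki : R)
  (Ibar : 'cV[R]_sig) (Vstar : 'cV[R]_rho) (ubar : 'cV[R]_m) :
  sym_posdef L -> sym_posdef C -> sym_psd Rm -> sym_psd G ->
  \rank B = m ->
  (forall i, 0 <= Vstar i 0) ->
  0 = Gam *m Vstar + Rm *m Ibar - B *m ubar ->
  0 = Gam^T *m Ibar - G *m Vstar ->
  0 < kd -> 0 < ki ->
  (* (a) passivity of mu_s |-> us' *)
  passive_mu_to_dus L Rm C G Gam B kd ki ubar /\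
  (* (b) convergence to the set {V' = 0, I' = 0, us' = 0, us = ubar} *)
  ((sym_posdef Rm /\ sym_posdef G) \/ (sym_posdef Rm /\ \rank Gam = rho)
     \/ (sym_posdef G /\ \rank Gam^T = sig) ->
   forall I V us, closed_loop L Rm C G Gam B kd ki ubar (fun _ => 0) I V us ->
     [/\ (derive1 V) t @[t --> +oo] --> (0 : 'cV[R]_rho),
         (derive1 I) t @[t --> +oo] --> (0 : 'cV[R]_sig),
         (derive1 us) t @[t --> +oo] --> (0 : 'cV[R]_m) &
         us t @[t --> +oo] --> ubar]) /\
  (* (c) with A_s of full rank: convergence to the unique operating point *)
  ((sym_posdef Rm /\ sym_posdef G) \/ (sym_posdef Rm /\ \rank Gam = rho)
     \/ (sym_posdef G /\ \rank Gam^T = sig) ->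
   \rank (block_mx Rm Gam Gam^T (- G)) = (sig + rho)%N ->
   (forall I V us, closed_loop L Rm C G Gam B kd ki ubar (fun _ => 0) I V us ->
     [/\ I t @[t --> +oo] --> Ibar,
         V t @[t --> +oo] --> Vstar,
         (derive1 I) t @[t --> +oo] --> (0 : 'cV[R]_sig),
         (derive1 V) t @[t --> +oo] --> (0 : 'cV[R]_rho) &
         us t @[t --> +oo] --> ubar]) /\
   (forall (I0 : 'cV[R]_sig) (V0 : 'cV[R]_rho) (u0 : 'cV[R]_m),
     closed_loop L Rm C G Gam B kd ki ubar (fun _ => 0)
       (fun _ => I0) (fun _ => V0) (fun _ => u0) ->
     [/\ I0 = Ibar, V0 = Vstar & u0 = ubar])).
Proof.
move=> pL pC psdR psdG _ _ eqI eqV kd0 ki0; split; last split.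
- exists (storage L C ki ubar); split=> [a b c d f|mu I V us cl t t0 s].
    exact: storage_ge0.
  have ds : is_derive t 1 s _ := is_derive_storage pL.1 pC.1 kd0 cl t0.
  rewrite derive1E; case: ds => ds ->; split=> //.
  by rewrite gerBl Q_ge0.
- by move=> cond I V us cl; exact: closed_loop_cvg cl cond.
move=> cond /steady_state_solve[P [P' [N [N' PN]]]].
have eqI' : Gam *m Vstar + Rm *m Ibar = B *m ubar.
  by apply/eqP; rewrite -subr_eq0 -eqI.
(* The operating point is the solution for the data [B *m ubar] and [0]. *)
have [IbarE VstarE] := PN Ibar Vstar; rewrite eqI' -eqV in IbarE VstarE.
split=> [I V us cl|I0 V0 u0 cl].
  have [v0 i0 _ u0] := closed_loop_cvg pL pC psdR psdG kd0 ki0 cl cond.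
  (* Along a trajectory the data are these right-hand sides, which tend to [B *m ubar] and [0];
     linearity carries the limit over to [I] and [V]. *)
  have eqs t : 0 < t ->
      Gam *m V t + Rm *m I t = B *m us t - L *m derive1 I t /\
      Gam^T *m I t - G *m V t = C *m derive1 V t.
    move=> /cl[_ [eI eV _ _ _]]; split; last by rewrite eV.
    by rewrite eI [RHS]addrC subrK.
  have BL : B *m us t - L *m derive1 I t @[t --> +oo] --> B *m ubar.
    rewrite -[B *m ubar]subr0; apply: cvgB; last exact: cvg_mulmxl0.
    exact: cvg_mulmxl.
  have Cv : C *m derive1 V t @[t --> +oo] --> (0 : 'cV[R]_rho).
    exact: cvg_mulmxl0.
  split=> //.
    rewrite IbarE; apply: (@eq_cvgy _ _ 0 (fun t =>
        P *m (B *m us t - L *m derive1 I t) + P' *m (C *m derive1 V t))).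
      by move=> t /eqs[<- <-]; case: (PN (I t) (V t)).
    by apply: cvgD; exact: cvg_mulmxl.
  rewrite VstarE; apply: (@eq_cvgy _ _ 0 (fun t =>
      N *m (B *m us t - L *m derive1 I t) + N' *m (C *m derive1 V t))).
    by move=> t /eqs[<- <-]; case: (PN (I t) (V t)).
  by apply: cvgD; exact: cvg_mulmxl.
(* For a constant solution any positive time will do: the derivatives vanish, the control law forces
   [u0 = ubar], and the data coincide with those of the operating point. *)
have [_ [+ + _ _ +]] := cl 1 ltr01.
rewrite !derive1_cst !mulmx0 oppr0 subr0 sub0r => eI eV eu.
have u0E : u0 = ubar.
  apply/eqP; rewrite -subr_eq0; move/esym/eqP: eu; rewrite scalerN oppr_eq0.
  by rewrite !scaler_eq0 invr_eq0 !gt_eqF.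
have eI' : Gam *m V0 + Rm *m I0 = B *m ubar.
  by apply/eqP; rewrite -subr_eq0 -u0E -eI.
have [I0E V0E] := PN I0 V0; rewrite eI' -eV in I0E V0E.
by split=> //; [rewrite I0E -IbarE|rewrite V0E -VstarE].
Qed.
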